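(* Let $\lambda\ge0,\mu\ge0$ and let $G$ be a graph in which every ball is convex and which satisfies the $(\lambda,\mu)$-bow metric. Then $G$ has slimness at most $\frac52\max\{2,\lambda+2\mu+1\}$ and is $\frac52\max\{2,\lambda+2\mu+1\}$-hyperbolic.
   Context: All graphs are finite, simple, unweighted, undirected and connected, with shortest-path distance $d$. The interval is $I(u,v)=\{z: d(u,z)+d(z,v)=d(u,v)\}$; a vertex set $S$ is convex if $I(x,y)\subseteq S$ for all $x,y\in S$; the ball is $B(v,r)=\{u: d(u,v)\le r\}$. A graph satisfies the $(\lambda,\mu)$-bow metric if for all vertices $u,v,w,x$ with $v\in I(u,w)$, $w\in I(v,x)$ and $d(v,w)>\lambda$, one has $d(u,x)\ge d(u,v)+d(v,w)+d(w,x)-\mu$. $G$ is $\delta$-hyperbolic if for any four vertices the two largest of the sums $d(u,v)+d(w,x)$, $d(u,w)+d(v,x)$, $d(u,x)+d(v,w)$ differ by at most $2\delta$. A geodesic triangle (union of shortest paths $P(u,v),P(v,w),P(w,u)$) is $\varsigma$-slim if every vertex of each side is within distance $\varsigma$ of the union of the other two sides; the slimness of $G$ is the least $\varsigma$ such that all geodesic triangles are $\varsigma$-slim. *)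

(* Defs.v *)
From mathcomp Require Import all_boot all_order all_algebra.
Set Implicit Arguments.
Unset Strict Implicit.
Unset Printing Implicit Defensive.
Import Order.TTheory GRing.Theory Num.Theory.

Section Graph.
Variables (V : finType) (e : rel V).

Definition simple_graph : Prop := symmetric e /\ irreflexive e.

Definition connected_graph : Prop := forall u v : V, connect e u v.

Definition walk_of_length (u v : V) (n : nat) : bool :=
  [exists p : n.-tuple V, path e u p && (last u p == v)].

(* The least length of a walk from [u] to [v]. Searching the lengths below
   [#|V|] suffices, since a shortest walk has no repeated vertex; the value is
   the junk [#|V|] exactly when [u] and [v] are not connected. *)
Definition dist (u v : V) : nat := find (walk_of_length u v) (iota 0 #|V|).

Definition interval (u v : V) : {set V} :=
  [set z | dist u z + dist z v == dist u v].

Definition convex (S : {set V}) : Prop :=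
  forall x y : V, x \in S -> y \in S -> interval x y \subset S.

(* Distances are integers, so integer radii give all balls. *)
Definition ball (v : V) (r : nat) : {set V} := [set u | dist u v <= r].

Definition convex_balls : Prop := forall (v : V) (r : nat), convex (ball v r).

(* [p] lists the vertices of the path after the first one: the vertex sequence
   of the shortest path is [u :: p]. *)
Definition shortest_path (u v : V) (p : seq V) : Prop :=
  [/\ path e u p, last u p = v & size p = dist u v].

Local Open Scope ring_scope.
Variable R : realFieldType.

Definition bow_metric (lambda mu : R) : Prop :=
  forall u v w x : V,
    v \in interval u w -> w \in interval v x -> lambda < (dist v w)%:R ->
    (dist u x)%:R >= (dist u v)%:R + (dist v w)%:R + (dist w x)%:R - mu.

Definition hyperbolic (delta : R) : Prop :=
  forall u v w x : V,
    let sums := sort geq [:: (dist u v + dist w x)%N;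
                             (dist u w + dist v x)%N;
                             (dist u x + dist v w)%N] in
    (nth 0%N sums 0)%:R - (nth 0%N sums 1)%:R <= 2 * delta.

Definition side_within (s : R) (A B : seq V) : Prop :=
  forall z : V, z \in A -> exists2 y : V, y \in B & (dist z y)%:R <= s.

Definition slim_triangle (s : R) (A B C : seq V) : Prop :=
  [/\ side_within s A (B ++ C), side_within s B (C ++ A)
    & side_within s C (A ++ B)].

Definition slim (s : R) : Prop :=
  forall (u v w : V) (p q r : seq V),
    shortest_path u v p -> shortest_path v w q -> shortest_path w u r ->
    slim_triangle s (u :: p) (v :: q) (w :: r).

(* The condition [0 <= s] only matters when [V] is empty: otherwise it follows
   from [slim s], and without it the empty graph would have no least [s]. *)
Definition is_slimness (s : R) : Prop :=
  [/\ 0 <= s, slim s & forall t : R, 0 <= t -> slim t -> s <= t].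

End Graph.

(* Main.v *)
(* Write [x ~ y] for adjacency. Convexity of balls yields a triangle-pentagon
   condition: if [x ~ y] are at distance [k] from [u], they have a common
   neighbour at level [k - 1], or a vertex at level [k - 2] is at distance 2 from
   both. From it one obtains, by induction on the perimeter, that a metric
   triangle (the intervals issuing from each corner meet only there) is either
   equilateral or has sides 2, 2, 1, and that in the equilateral case each corner
   is equidistant from the whole opposite interval. In an equilateral triangle
   [u v w] of side [k], choose [p] in I(v,w) and [q] in I(u,w) at distance [m]
   from [w]; then [d p q = m], and [v], [p], [q], [u] violate the bow inequality
   as soon as [m > lambda] and [k - m > mu]. So metric triangles have sides at
   most K = max(2, lambda + 2 mu + 1). Two points at the same level of an interval
   span a metric triangle with a third vertex, so intervals are K-thin, and a
   geodesic triangle is compared with the quasi-median of its corners: a vertex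
   of a side is moved into a second side by at most K + K/2 + K. *)
Require Import Defs.
From mathcomp Require Import all_boot all_order all_algebra.
From mathcomp Require Import zify lra.
From Stdlib Require Import Classical.
Import Order.TTheory GRing.Theory Num.Theory.
Set Implicit Arguments.
Unset Strict Implicit.
Unset Printing Implicit Defensive.

(** * Metric triangles in discrete geodesic spaces with convex balls *)

Section ConvexBalls.

Variables (V : finType) (d : V -> V -> nat).
Hypothesis dxx : forall x, d x x = 0.
Hypothesis d_eq0 : forall x y, d x y = 0 -> x = y.
Hypothesis dC : forall x y, d x y = d y x.
Hypothesis dT : forall x y z, d x z <= d x y + d y z.
Hypothesis geodesic : forall x y n, n <= d x y ->
  exists2 z, d x z = n & d x z + d z y = d x y.
Hypothesis ball_convex : forall v r x y z,
  d v x <= r -> d v y <= r -> d x z + d z y = d x y -> d v z <= r.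

Ltac dsym :=
  repeat match goal with
  | H : context [d ?x ?y] |- _ =>
    lazymatch goal with
    | _ : d x y = d y x |- _ => fail
    | _ : d y x = d x y |- _ => fail
    | _ => pose proof (dC x y)
    end
  end.
Ltac dlia := intros; dsym; lia.

Lemma ball_midpoint v r x y z : d x z = 1 -> d z y = 1 -> 2 <= d x y ->
  d v x <= r -> d v y <= r -> d v z <= r.
Proof.
move=> xz zy xy vx vy; apply: (ball_convex vx vy).
by have := dT x z y; dlia.
Qed.

Lemma step x y : 0 < d x y -> exists2 t, d x t = 1 & (d t y).+1 = d x y.
Proof. by move=> /geodesic[t xt tE]; exists t => //; dlia. Qed.

(** Otherwise [x] would be a midpoint of [y] and [z], and convexity would put it in the ball of
    radius [(d u x).-1] about [u]. *)
Lemma descent_clique u x y z : d x y = 1 -> d x z = 1 ->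
  d u y < d u x -> d u z < d u x -> d y z <= 1.
Proof.
move=> xy xz uy uz; case: (leqP (d y z) 1) => // yz.
suff: d u x <= (d u x).-1 by lia.
by apply: (@ball_midpoint _ _ y z); dlia.
Qed.

(* [x1] can be chosen freely among the neighbours of [x] towards [u]; this is
   what lets the triangle-pentagon condition be iterated. *)
Lemma triangle_pentagon k u x y x1 :
  d u x = k -> d u y = k -> d x y = 1 -> d x x1 = 1 -> (d u x1).+1 = k ->
  (exists t, [/\ d x t = 1, d y t = 1 & (d u t).+1 = k]) \/
  (exists t, [/\ d x1 t = 1, (d u t).+2 = k & d y t = 2]).
Proof.
elim/ltn_ind: k u x y x1 => k IH u x y x1 ux uy xy xx1 ux1.
have [y1 yy1 uy1] : exists2 t, d y t = 1 & (d u t).+1 = k.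
  have [|t yt tE] := @step y u; first by dlia.
  by exists t => //; dlia.
have [x1y|x1y] := leqP (d x1 y) 1.
  left; exists x1; split=> //.
  by have := dT u x1 y; dlia.
have [xy1|xy1] := leqP (d x y1) 1.
  left; exists y1; split=> //.
  by have := dT u y1 x; dlia.
have x1y2 : d x1 y = 2 by have := dT x1 x y; dlia.
have xy12 : d x y1 = 2 by have := dT x y y1; dlia.
have x1y1_le : d x1 y1 <= 2.
  have := dT x1 x y1; rewrite leqNgt => x1y1; apply/negP => x1y1'.
  suff: d u x <= k.-1 by lia.
  by apply: (@ball_convex _ _ x1 y1); dlia.
have x1y1 : d x1 y1 = 2.
  have := dT x x1 y1 => le2; case: (leqP (d x1 y1) 1); last by dlia.
  move=> ?; suff: d x1 y <= 1 by lia.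
  by apply: (@ball_midpoint _ _ x y1); dlia.
have [k1|k2|k3|k4] : [\/ k = 1, k = 2, k = 3 | 3 < k].
- by case: (k) ux1 => [|[|[|[|k']]]] //; constructor.
- by have := dT x1 u y1; dlia.
- right; exists u; rewrite dxx; split; dlia.
- have [|x2 x1x2 ux2] := @step x1 u; first by dlia.
  right; exists x2; split=> //; first by dlia.
  have y1x2 : d y1 x2 <= 2 by apply: (@ball_convex _ _ x1 u); dlia.
  have : d x2 y <= 2.
    apply: (@ball_midpoint _ _ x y1); try dlia.
    by have := dT x2 x1 x; dlia.
  by have := dT u x2 y; dlia.
(* At level [k - 2] the midpoint [z] closes a pentagon; at level [k - 1] the induction hypothesis
   applies to the edge [x1 z]. *)
have [|z x1z zE] := @geodesic x1 y1 1; first by dlia.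
have uz : d u z <= k.-1 by apply: (@ball_convex _ _ x1 y1); dlia.
have zlow : k <= (d u z).+2 by have := dT u z x1; dlia.
have [uz2|uz1] : (d u z).+2 = k \/ (d u z).+1 = k by lia.
  right; exists z; split => //.
  by have := dT y y1 z; have := dT u z y; dlia.
have [|g1 x1g1 g1u] := @step x1 u; first by dlia.
have near t : d x1 t = 1 -> d y1 t <= 2 -> (d u t).+2 = k -> d y t = 2.
  move=> x1t y1t ut; have : d t y <= 2.
    apply: (@ball_midpoint _ _ x y1); try dlia.
    by have := dT t x1 x; dlia.
  by have := dT u t y; dlia.
have [||||||[g [x1g zg ug]]|[g0 [g1g0 ug0 zg0]]] :=
  @IH k.-1 _ u x1 z g1; try dlia.
  right; exists g; split; try dlia.
  by apply: near; try dlia; have := dT y1 z g; dlia.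
have x1g0 : d x1 g0 <= 2 by have := dT x1 g1 g0; dlia.
have g0x : d g0 x <= 3 by have := dT g0 x1 x; dlia.
have g0y1 : d g0 y1 <= 3 by have := dT g0 z y1; dlia.
have g0y : d g0 y <= 3 by apply: (@ball_midpoint _ _ x y1); dlia.
(* [g0] is at level [k - 3] and at distance 3 from [x] and [y], so the induction hypothesis applies
   with base point [g0] and [3 < k]. *)
have [||||||[t [xt yt g0t]]|[t [x1t g0t yt]]] := @IH 3 _ g0 x y x1; try dlia.
- by have := dT u g0 x; dlia.
- by have := dT u g0 y; dlia.
- by have := dT u g0 x1; dlia.
- left; exists t; split=> //.
  by have := dT u g0 t; have := dT u t x; dlia.
- right; exists t; split=> //.
  by have := dT u g0 t; have := dT u t x1; dlia.
Qed.

(** * Gated corners and metric triangles *)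

Definition gated x y z : Prop := forall t,
  d x t + d t y = d x y -> d x t + d t z = d x z -> t = x.

Definition metric_triangle u v w : Prop :=
  [/\ gated u v w, gated v w u & gated w u v].

Lemma gatedC x y z : gated x y z -> gated x z y.
Proof. by move=> g t tz ty; apply: g. Qed.

Lemma gated_adj x y z t : gated x y z -> d x t = 1 -> d t y < d x y ->
  d x z <= d t z.
Proof.
move=> g xt ty; rewrite leqNgt; apply/negP => tz.
have : t = x by apply: g; have := dT x t y; have := dT x t z; dlia.
by move=> tx; move: xt; rewrite tx dxx.
Qed.

(** The first step from [x] towards a common vertex [t] already lies in both intervals. *)
Lemma gated_of_adj x y z :
  (forall t, d x t = 1 -> d t y < d x y -> d x z <= d t z) -> gated x y z.
Proof.
move=> H t ty tz; have [/esym|xt] := posnP (d x t).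
  by move=> xt; apply/esym/d_eq0.
have [s xs st] := step xt.
have : d x z <= d s z by apply: H => //; have := dT s t y; dlia.
by have := dT s t z; dlia.
Qed.

Lemma gated_sub x y z y' z' : gated x y z ->
  d x y' + d y' y = d x y -> d x z' + d z' z = d x z -> gated x y' z'.
Proof.
move=> g y'y z'z t ty tz; apply: g.
- by have := dT t y' y; have := dT x t y; dlia.
- by have := dT t z' z; have := dT x t z; dlia.
Qed.

(** Take [t] farthest from [u] in the intersection of the two intervals. *)
Lemma exists_gated u x y : exists t,
  [/\ d u t + d t x = d u x, d u t + d t y = d u y & gated t x y].
Proof.
pose P t := (d u t + d t x == d u x) && (d u t + d t y == d u y).
have Pu : P u by rewrite /P dxx !eqxx.
case: (arg_maxnP (fun t => d u t) Pu) => t /andP[/eqP tx /eqP ty] tmax.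
exists t; split=> // s sx sy; have := tmax s; rewrite /P => smax.
suff : d t s = 0 by move=> /d_eq0.
have := dT u t s; have := dT u s x; have := dT u s y => sy1 sx1 us.
by have := smax ltac:(apply/andP; split; apply/eqP; lia); lia.
Qed.

Lemma metric_triangle_rot u v w : metric_triangle u v w -> metric_triangle v w u.
Proof. by case=> *; split. Qed.

Lemma metric_triangle_sym u v w : metric_triangle u v w -> metric_triangle v u w.
Proof. by case=> *; split; apply: gatedC. Qed.

Lemma exists_metric_triangle u x y : gated x y u -> gated y u x ->
  exists t, [/\ d u t + d t x = d u x, d u t + d t y = d u y
              & metric_triangle t x y].
Proof.
move=> gx gy; have [t [tx ty gt]] := exists_gated u x y.
exists t; split=> //; split=> //.
- by apply: (gated_sub gx); rewrite ?dxx; dlia.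
- by apply: (gated_sub gy); rewrite ?dxx; dlia.
Qed.

(* The triangles with sides 2, 2, 1 are those inscribed in a pentagon. *)
Definition metric_type (a b c : nat) : Prop :=
  (a = b /\ b = c) \/
  [\/ [/\ a = 2, b = 2 & c = 1], [/\ a = 2, b = 1 & c = 2]
    | [/\ a = 1, b = 2 & c = 2]].


Lemma midpoint x y : d x y = 2 -> exists2 z, d x z = 1 & d z y = 1.
Proof. by move=> xy; have [|z xz zy] := @step x y; [lia | exists z; lia]. Qed.

(** * Descending along a side of a metric triangle *)

Section Descent.

Variables u v w : V.
Hypothesis uvw : metric_triangle u v w.
Hypothesis wu_uv : d w u <= d u v.

Lemma side_level x : d v x + d x w = d v w -> d u x <= d u v.
Proof. by move=> vx; apply: (@ball_convex u _ v w); dlia. Qed.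

Lemma uv_level_adj x : d v x = 1 -> d x w < d v w -> d u x = d u v.
Proof.
move=> vx xw; have [_ gv _] := uvw; have := gated_adj gv vx xw.
by have := @side_level x; have := dT v x w; dlia.
Qed.


Variable y : V.
Hypothesis yw : (d y w).+2 = d v w.
Hypothesis uy : (d u y).+1 = d u v.

(** [t] and [x] differ in level. If they were adjacent, [descent_clique] at [x] would put [t] within
    1 of [y], so [t] would leave [v] towards both [u] and [w]. *)
Lemma no_common_neighbor x t : d v x = 1 -> d x y = 1 -> d v t = 1 ->
  (d u t).+1 = d u v -> 2 <= d t x.
Proof.
move=> vx xy vt ut; rewrite leqNgt; apply/negP => tx.
have [_ gv _] := uvw; have xw : d x w < d v w by have := dT x y w; dlia.
have ux := uv_level_adj vx xw.
have tw : d v w <= d t w by apply: (gated_adj (gatedC gv)); dlia.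
suff : d t y <= 1 by have := dT t y w; dlia.
have [t0|t1] : d t x = 0 \/ d t x = 1 by lia.
  by have := dT u t x; dlia.
by apply: (@descent_clique u x); dlia.
Qed.

(** In [triangle_pentagon] on the edge [x v], [no_common_neighbor] excludes the triangle; the
    pentagon [v x y r s] remains. *)
Lemma descent_pentagon x : d v x = 1 -> d x y = 1 -> exists r s,
  [/\ d y r = 1, (d u r).+2 = d u v, d v r = 2 & (d r w).+1 = d v w] /\
  [/\ d v s = 1, d s r = 1, (d u s).+1 = d u v & d v w <= d s w].
Proof.
move=> vx xy; have [_ gv _] := uvw.
have xw : d x w < d v w by have := dT x y w; dlia.
have ux := uv_level_adj vx xw.
have [|||||[t [xt vt ut]]|[r [yr ur vr]]] := @triangle_pentagon (d u v) u x v y;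
  try dlia.
  by have := no_common_neighbor vx xy vt ut; dlia.
have [s vs sr] := midpoint vr.
have us : (d u s).+1 = d u v by have := dT u r s; have := dT u s v; dlia.
have sw : d v w <= d s w by apply: (gated_adj (gatedC gv)); dlia.
exists r, s; split; split=> //.
by have := dT s r w; have := dT r y w; dlia.
Qed.

End Descent.

(** * Non-equilateral metric triangles *)

Section NonEquilateral.

Variables u v w : V.
Hypothesis uvw : metric_triangle u v w.
Hypothesis IH : forall x y z,
  d x y + d y z + d z x < d u v + d v w + d w u -> metric_triangle x y z ->
  metric_type (d x y) (d y z) (d z x).
Hypothesis wu_uv : d w u < d u v.

Let wu_uvW : d w u <= d u v := ltnW wu_uv.

(** If no second step towards [w] dropped a level, [x] would be gated towards [w] and [u]. The
    resulting smaller metric triangle has unequal sides at [u'], hence type 2, 2, 1, which is then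
    refuted near [v]. *)
Lemma exists_descent : exists x y,
  [/\ d v x = 1, (d x w).+1 = d v w, d x y = 1,
      (d y w).+2 = d v w & (d u y).+1 = d u v].
Proof.
have [gu gv gw] := uvw.
have [vw0|vw_gt0] := posnP (d v w).
  by have := dT u w v; dlia.
have [x vx xw] := step vw_gt0.
have ux : d u x = d u v by apply: (uv_level_adj uvw) => //; lia.
pose found := [exists y, [&& d x y == 1, (d y w).+2 == d v w & (d u y).+1 == d u v]].
have [/existsP[y /and3P[/eqP xy /eqP yw /eqP uy]]|/existsPn nf] := boolP found.
  by exists x, y.
exfalso.
have gx : gated x w u.
  apply: gated_of_adj => t xt tw; rewrite leqNgt; apply/negP => tu.
  have := dT x t w; have := dT x t u => xu xw'.
  by move/negP: (nf t); apply; apply/and3P; split; apply/eqP; dlia.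
have gwx : gated w u x by apply: (gated_sub gw); rewrite ?dxx; dlia.
have [u' [u'x u'w tri]] := exists_metric_triangle gx gwx.
have lt : d u' x + d x w + d w u' < d u v + d v w + d w u by dlia.
have := IH lt tri; have [gu' gx' gw'] := tri.
have uv3 := dT u x v.
case=> [|[[]|[]|[]]]; try dlia.
move=> u'x2 xw2 wu'1.
have [|p xp pu'] := @midpoint x u'; first by dlia.
have [|q xq qw] := @midpoint x w; first by dlia.
have pw : 2 <= d p w by have := gated_adj gx' xp; dlia.
have qu' : 2 <= d q u' by have := gated_adj (gatedC gx') xq; dlia.
have vu' : 3 <= d v u' by have := gated_adj gw (t := u'); dlia.
have up : (d u p).+1 = d u v by have := dT u u' p; have := dT u p x; dlia.
have no_common t : d v t = 1 -> (d u t).+1 = d u v -> 2 <= d t x.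
  move=> vt ut; rewrite leqNgt; apply/negP => tx.
  have tw : d v w <= d t w by apply: (gated_adj (gatedC gv)); dlia.
  have tp : d t p <= 1.
    have [t0|t1] : d t x = 0 \/ d t x = 1 by lia.
      by have := dT u t x; dlia.
    by apply: (@descent_clique u x); dlia.
  have tu' : d t u' <= 2 by have := dT t p u'; dlia.
  have tq : d t q <= 2 by have := dT t x q; dlia.
  suff : d t w <= 2 by dlia.
  by apply: (@ball_midpoint _ _ q u'); dlia.
have [|||||[t [xt vt ut]]|[r [pr ur vr]]] := @triangle_pentagon (d u v) u x v p;
  try dlia.
  by have := no_common t vt ut; dlia.
have [s vs sr] := midpoint vr.
have us : (d u s).+1 = d u v by have := dT u r s; have := dT u s v; dlia.
have sx := no_common s vs us.
have ru' : d r u' <= 1 by apply: (@descent_clique u p); dlia.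
have su' : d u' s <= 2 by have := dT u' r s; dlia.
suff : d u' v <= 2 by dlia.
by apply: (@ball_midpoint _ _ s x); dlia.
Qed.

Lemma non_equilateral_type : d v w <= d u v ->
  [/\ d u v = 2, d v w = 2 & d w u = 1].
Proof.
move=> vw_uv; have [x [y [vx xw xy yw uy]]] := exists_descent.
have [r [s [[yr ur vr rw] [vs sr us sw]]]] :=
  descent_pentagon uvw wu_uvW yw uy vx xy.
have [gu gv gw] := uvw.
have vy2 : d v y = 2 by have := dT v x y; have := dT v y w; dlia.
have sx : 2 <= d s x by apply: (no_common_neighbor uvw wu_uvW yw uy).
have wu : (d w u).+1 = d u v.
  (* If [w] were at level at most [d u v - 2], as [r] is, so would be [y], which lies in I(r,w). *)
  have [//|wu] : (d w u).+1 = d u v \/ (d w u).+2 <= d u v by lia.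
  suff : d u y <= (d u v).-2 by lia.
  by apply: (@ball_convex _ _ r w); dlia.
have [uv2|uv3] : d u v = 2 \/ 3 <= d u v by lia.
  have /d_eq0 ur0 : d u r = 0 by lia.
  by subst r; split; dlia.
exfalso.
have yw_gt0 : 0 < d y w.
  rewrite lt0n; apply/eqP => yw0; have ru : r = u.
    apply: gu; first by dlia.
    by have := dT u r w; dlia.
  by move: ur; rewrite ru dxx; lia.
have uw_far t : d w t = 1 -> (d u t).+2 = d u v -> d v w <= d v t.
  by move=> wt ut; have := gated_adj gw wt; dlia.
(* If [d t r = d v w - 1], then [y] lies in I(r,t) and would be one level too low. If [t] is nearer
   to [r], then [s] and [x] pull their midpoint [v] too close to [t]. *)
have no_shortcut t : d w t = 1 -> (d u t).+2 = d u v -> (d t y).+2 <= d v w ->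
    False.
  move=> wt ut ty; have vt := uw_far t wt ut.
  have tr_le : d t r <= d t y + 1 by have := dT t y r; dlia.
  have [tr|tr] := leqP (d v w) (d t r).+1.
    have : d u y <= (d u v).-2 by apply: (@ball_convex _ _ r t); dlia.
    by lia.
  have ts : d t s <= (d v w).-1 by have := dT t r s; dlia.
  have tx : d t x <= (d v w).-1 by have := dT t y x; dlia.
  have : d t v <= (d v w).-1 by apply: (@ball_midpoint _ _ s x); dlia.
  by dlia.
have gy : gated y w u.
  apply: gated_of_adj => t yt tw; rewrite leqNgt; apply/negP => tu.
  have : d t r <= 1 by apply: (@descent_clique u y); dlia.
  by have := dT r t w; dlia.
have gwy : gated w u y by apply: (gated_sub gw); rewrite ?dxx; dlia.
have [u' [u'y u'w tri]] := exists_metric_triangle gy gwy.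
have lt : d u' y + d y w + d w u' < d u v + d v w + d w u.
  by dlia.
have typ := IH lt tri.
(* [y] and [w] are equidistant from [u], so the two sides at [u'] are equal. *)
have [eqY|[yw1 u'y2 wu'2]] :
  (d u' y = d y w /\ d y w = d w u') \/ [/\ d y w = 1, d u' y = 2 & d w u' = 2].
  by case: typ => [|[[]|[]|[]]] *; [left|exfalso; dlia|right; split|exfalso]; dlia.
  have [|t wt tu'] := @step w u'; first by lia.
  apply: (no_shortcut t wt).
    by have := dT u u' t; have := dT u t w; dlia.
  have : d y t <= d y w by apply: (@ball_convex _ _ w u'); dlia.
  by dlia.
have vw3 : d v w = 3 by lia.
have [|||||[t [yt wt ut]]|[r2 [rr2 ur2 wr2]]] :=
  @triangle_pentagon (d u v).-1 u y w r; try dlia.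
  by apply: (no_shortcut t wt); dlia.
have [z wz zr2] := midpoint wr2.
have uz : (d u z).+2 = d u v by have := dT u r2 z; have := dT u z w; dlia.
have zy : 2 <= d z y.
  by rewrite leqNgt; apply/negP => zy; apply: (no_shortcut z wz uz); lia.
have vr2 : d v r2 = 3 by have := dT v r r2; have := dT u r2 v; dlia.
have vz : d v z = 3.
  have := uw_far z wz uz; have zs : d z s <= 3.
    by have := dT z r2 s; have := dT r2 r s; dlia.
  have zx : d z x <= 3 by have := dT z w x; dlia.
  have : d z v <= 3 by apply: (@ball_midpoint _ _ s x); dlia.
  by dlia.
(* [r2 ~ z ~ w] all lie at distance 3 from [v]; the triangle-pentagon condition
   cannot give triangles on both of these edges. *)
have AB t t' : d r2 t = 1 -> d z t = 1 -> d v t = 2 ->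
    d w t' = 1 -> d z t' = 1 -> d v t' = 2 -> False.
  move=> r2t zt vt wt' zt' vt'.
  have tt' : d t t' <= 1 by apply: (@descent_clique v z); dlia.
  have t'y : d t' y <= 1 by apply: (@descent_clique v w); dlia.
  have tr : d t r <= 1 by apply: (@descent_clique v r2); dlia.
  have notw q : d v q = 2 -> d w q = 1 -> 2 <= d r2 q.
    move=> vq wq; rewrite leqNgt; apply/negP => r2q.
    have qw : q = w.
      have qr2 := dT q r2 u; have wqu := dT w q u; have vqw := dT v q w.
      by apply: gw; dlia.
    by move: wq; rewrite qw dxx.
  have zr : 2 <= d z r.
    rewrite leqNgt; apply/negP => zr.
    suff : d z y <= 1 by lia.
    by apply: (@ball_midpoint _ _ w r); dlia.
  have wt : 2 <= d w t.
    by rewrite leqNgt; apply/negP => wt; have := notw t vt; have := dT v t w; dlia.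
  have r2t' := notw t' vt' wt'.
  have [rt'|rt'] := leqP (d r t') 1.
    suff : d r z <= 1 by dlia.
    by apply: (@ball_midpoint _ _ r2 t'); dlia.
  have yt : d y t <= 1.
    have rt0 : d r t != 0 by apply/eqP => /d_eq0 rt; move: zr; rewrite rt; lia.
    have tt0 : d t t' != 0 by apply/eqP => /d_eq0 E; move: wt; rewrite E; lia.
    by apply: (@ball_midpoint _ _ r t'); dlia.
  suff : d y z <= 1 by dlia.
  by apply: (@ball_midpoint _ _ w t); dlia.
have noA t : d r2 t = 1 -> d z t = 1 -> d v t = 2 -> False.
  move=> r2t zt vt.
  have [|||||[t' [zt' wt' vt']]|[q [tq vq wq]]] :=
    @triangle_pentagon 3 v z w t; try dlia.
    by apply: (AB t t') => //; lia.
  have qw : d v w <= d q w.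
    have := dT u t q; have := dT u r2 t => *.
    by apply: (gated_adj (gatedC gv)); dlia.
  by dlia.
have noB t : d w t = 1 -> d z t = 1 -> d v t = 2 -> False.
  move=> wt zt vt.
  have [|||||[t' [zt' r2t' vt']]|[q [tq vq r2q]]] :=
    @triangle_pentagon 3 v z r2 t; try dlia.
    by apply: (AB t' t) => //; lia.
  have qu : d v u <= d q u.
    by have := dT q t w => *; apply: (gated_adj gv); dlia.
  by have := dT u r2 q; dlia.
(* Both edges now give pentagons, and [v] is a midpoint of [q] and [q'], which are at distance 2
   from [z]. *)
have [|||||[t [r2t zt vt]]|[q [rq vq zq]]] :=
    @triangle_pentagon 3 v r2 z r; try dlia.
  by apply: (noA t) => //; lia.
have [|||||[t [wt zt vt]]|[q' [yq' vq' zq']]] :=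
    @triangle_pentagon 3 v w z y; try dlia.
  by apply: (noB t) => //; lia.
have qq' : 2 <= d q q'.
  have := dT u r q; have := dT u q v => *.
  by apply: (no_common_neighbor uvw wu_uvW yw uy); dlia.
suff : d z v <= 2 by dlia.
by apply: (@ball_midpoint _ _ q q'); dlia.
Qed.

End NonEquilateral.

(** * Classification, and the equilateral case *)

Lemma metric_triangle_type u v w : metric_triangle u v w ->
  metric_type (d u v) (d v w) (d w u).
Proof.
have [n] := ubnP (d u v + d v w + d w u).
elim: n u v w => // n IH u v w; rewrite ltnS => le_n tri.
have core x y z : metric_triangle x y z ->
    d x y + d y z + d z x = d u v + d v w + d w u ->
    d z x < d x y -> d y z <= d x y -> [/\ d x y = 2, d y z = 2 & d z x = 1].
  move=> txyz per; apply: non_equilateral_type => // x' y' z' lt.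
  by apply: IH; lia.
(* [core] wants a longest side first and a strictly shorter one last; the six labellings cover all
   cases. *)
have tri1 := metric_triangle_rot tri; have tri2 := metric_triangle_rot tri1.
have tri' := metric_triangle_sym tri; have tri1' := metric_triangle_sym tri1.
have tri2' := metric_triangle_sym tri2.
have c1 := core _ _ _ tri; have c2 := core _ _ _ tri1.
have c3 := core _ _ _ tri2; have c4 := core _ _ _ tri'.
have c5 := core _ _ _ tri1'; have c6 := core _ _ _ tri2'.
have [eq|neq] : (d u v = d v w /\ d v w = d w u) \/
  (d u v != d v w) || (d v w != d w u) by lia.
  by left.
right; have [M|[M|M]] : (d v w <= d u v /\ d w u <= d u v) \/
  (d u v <= d v w /\ d w u <= d v w) \/ (d u v <= d w u /\ d v w <= d w u).
  by lia.
- have [lt|eq] : d w u < d u v \/ d v w < d u v by lia.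
    by case: c1; try dlia; constructor 1; split; dlia.
  by case: c4; try dlia; constructor 2; split; dlia.
- have [lt|eq] : d u v < d v w \/ d w u < d v w by lia.
    by case: c2; try dlia; constructor 3; split; dlia.
  by case: c5; try dlia; constructor 1; split; dlia.
- have [lt|eq] : d v w < d w u \/ d u v < d w u by lia.
    by case: c3; try dlia; constructor 2; split; dlia.
  by case: c6; try dlia; constructor 3; split; dlia.
Qed.

(** Moving [p] to its gate [p'] towards [w] and [u] yields a metric triangle [t p' w] with unequal
    sides at [t], because [d u p < d u w]. Its type 2, 2, 1 forces [p' = p]. *)
Lemma triangle_defect u v w k p : metric_triangle u v w ->
  d u v = k -> d v w = k -> d w u = k ->
  d v p + d p w = k -> d u p < k ->
  [/\ d p w = 2, (d u p).+1 = k &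
      exists t, [/\ d p t = 1, d t w = 2 & d u t + d t w = k]].
Proof.
move=> [gu gv gw] uv vw wu vpw up.
have [p' [p'w p'u gp']] := exists_gated p w u.
have gw' : gated w u p'.
  apply: (gated_sub gw); rewrite ?dxx; first by dlia.
  by have := dT p' p v; have := dT w p' v; dlia.
have [t [tp tw tri]] := exists_metric_triangle gp' gw'.
have := metric_triangle_type tri; case=> [|[[]|[]|[]]]; try dlia.
move=> tp'1 p'w2 wt2; have pp' : p' = p by apply/esym/d_eq0; dlia.
by subst p'; split; [| dlia | exists t; split; dlia].
Qed.

(** A vertex [z] closer to [u] would, by [triangle_defect] from both ends, be at distance 2 from [v]
    and [w]; the descent pentagon at [v] then puts [t] in both I(w,u) and I(w,v). *)
Lemma strongly_equilateral u v w k z : metric_triangle u v w ->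
  d u v = k -> d v w = k -> d w u = k -> d v z + d z w = k -> d u z = k.
Proof.
move=> tri uv vw wu vzw; have [_ gv gw] := tri.
have : d u z <= k by apply: (@ball_convex _ _ v w); dlia.
rewrite leq_eqVlt => /predU1P[//|uz]; exfalso.
have [zw uz1 [t [zt tw utw]]] := triangle_defect tri uv vw wu vzw uz.
have [|||||| zv _ _] := @triangle_defect u w v k z; try dlia.
  exact: metric_triangle_rot (metric_triangle_sym tri).
have [|x vx xz] := @midpoint v z; first by dlia.
have wu_uv : d w u <= d u v by lia.
rewrite -uv in uz1.
have zw' : (d z w).+2 = d v w by dlia.
have [r [s [[zr ur _ _] [vs sr us _]]]] :=
  descent_pentagon tri wu_uv zw' uz1 vx xz.
have sx := no_common_neighbor tri wu_uv zw' uz1 vx xz vs us.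
have rt : d r t <= 1 by apply: (@descent_clique u z); dlia.
have ts : d t s <= 2 by have := dT t r s; dlia.
have tx : d t x <= 2 by have := dT t z x; dlia.
have tv : d t v <= 2 by apply: (@ball_midpoint _ _ s x); dlia.
have tw0 : t = w.
  by have := dT w t v => *; apply: gw; dlia.
by move: tw; rewrite tw0 dxx.
Qed.

Lemma equilateral_bow u v w k m : metric_triangle u v w ->
  d u v = k -> d v w = k -> d w u = k -> 2 <= m <= k ->
  exists p q, [/\ d v p + m = k, d p q = m, d q u + m = k, d v q = k & d p u = k].
Proof.
move=> tri uv vw wu m_le; have [_ gv gw] := tri.
have [|p wp wpv] := @geodesic w v m; first by dlia.
have up : d u p = k by apply: (strongly_equilateral tri); dlia.
have gp : gated p w u.
  move=> z zw zu; have : d u z = k.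
    apply: (strongly_equilateral tri) => //.
    by have := dT v z w; have := dT v p z; dlia.
  by move=> uz; apply/esym/d_eq0; dlia.
have gw' : gated w u p by apply: (gated_sub gw); rewrite ?dxx; dlia.
have [q [qp qw triq]] := exists_metric_triangle gp gw'.
(* The sides at [q] are equal, so the only other type is 2, 1, 2, excluded by [2 <= m]. *)
have qp_m : d q p = m.
  by have := metric_triangle_type triq; case=> [|[[]|[]|[]]]; dlia.
have vq : d v q = k.
  by apply: (strongly_equilateral (metric_triangle_rot tri)); dlia.
by exists p, q; split; dlia.
Qed.

(** * Thin intervals, slim sides and the four-point condition *)

Section BoundedTriangles.

Variable N : nat.
Hypothesis metric_triangle_le : forall u v w, metric_triangle u v w -> d u v <= N.

(** Balls about [u] and about [v] contain I(x,y), which therefore stays in one level of I(u,v); so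
    [x] and [y] are gated corners. *)
Lemma slice_diam u v x y : d u x + d x v = d u v -> d u y + d y v = d u v ->
  d u x = d u y -> d x y <= N.
Proof.
have gate s t : d u s + d s v = d u v -> d u t + d t v = d u v ->
    d u s = d u t -> gated s t u.
  move=> us ut st z zt zu.
  have uz : d u z <= d u s by apply: (@ball_convex _ _ s t); dlia.
  have vz : d v z <= d v s by apply: (@ball_convex _ _ s t); dlia.
  by apply/esym/d_eq0; have := dT u z v; dlia.
move=> ux uy xy; have gx := gate x y ux uy xy.
have gy := gate y x uy ux (esym xy).
have [t [_ _ tri]] := exists_metric_triangle gx (gatedC gy).
exact: metric_triangle_le (metric_triangle_rot tri).
Qed.

Lemma interval_thin u v x y : d u x + d x v = d u v -> d u y + d y v = d u v ->
  d x y <= N + (d u x - d u y) + (d u y - d u x).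
Proof.
wlog xy : x y / d u x <= d u y.
  move=> H ux uy; have [le|le] := leqP (d u x) (d u y); first exact: H.
  by have := H y x (ltnW le) uy ux; dlia.
move=> ux uy; have [z uz zy] := geodesic xy.
have : d x z <= N.
  by apply: (@slice_diam u v) => //; have := dT u z v; have := dT z y v; dlia.
by have := dT x z y; dlia.
Qed.

Lemma exists_quasi_median u v w : exists u' v' w',
  [/\ metric_triangle u' v' w',
      d u u' + d u' v' + d v' v = d u v,
      d v v' + d v' w' + d w' w = d v w
    & d w w' + d w' u' + d u' u = d w u].
Proof.
have [u' [u'v u'w gu]] := exists_gated u v w.
have [v' [v'u' v'w gv]] := exists_gated v u' w.
have [w' [w'u' w'v' gw]] := exists_gated w u' v'.
exists u', v', w'; split; try dlia; split=> //.
- by apply: (gated_sub gu); dlia.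
- by apply: gatedC; apply: (gated_sub gv); rewrite ?dxx; dlia.
Qed.

(** Every [y] at the level [t] will do, so the bound applies to whichever shortest path forms the
    side. *)
Lemma near_side u v w z : d u z + d z v = d u v ->
  (exists2 t, t <= d u w & forall y, d u y + d y w = d u w -> d u y = t ->
    2 * d z y <= 5 * N) \/
  (exists2 t, t <= d v w & forall y, d v y + d y w = d v w -> d v y = t ->
    2 * d z y <= 5 * N).
Proof.
move=> uzv; have [u' [v' [w' [tri uv vw wu]]]] := exists_quasi_median u v w.
have gN := metric_triangle_le tri.
(* Before [a'], two slices at the level of [z] suffice. Beyond it, [z] crosses a slice, goes back at
   most half of a geodesic from [a'] to [b'], and crosses a second slice. *)
have half a b a' b' c' : d a z + d z b = d a b ->
    d a a' + d a' b' + d b' b = d a b -> d a' b' <= N ->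
    d c' w + d c' a' + d a' a = d w a -> 2 * d a z <= 2 * d a a' + d a' b' ->
    exists2 t, t <= d a w & forall y, d a y + d y w = d a w -> d a y = t ->
      2 * d z y <= 5 * N.
  move=> az ab a'b' aw le.
  have a'w : d a a' + d a' w = d a w.
    by have := dT a a' w; have := dT a' c' w; dlia.
  have a'b : d a a' + d a' b = d a b.
    by have := dT a a' b; have := dT a' b' b; dlia.
  have [za'|a'z] := leqP (d a z) (d a a').
    exists (d a z); first by lia.
    have [x ax xa'] := geodesic za'.
    move=> y yw ay; have zx : d z x <= N.
      apply: (@slice_diam a b) => //.
      by have := dT a x b; have := dT x a' b; dlia.
    have xy : d x y <= N.
      apply: (@slice_diam a w) => //; last by dlia.
      by have := dT a x w; have := dT x a' w; dlia.
    by have := dT z x y; dlia.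
  exists (d a a'); first by lia.
  have [|x a'x xb'] := @geodesic a' b' (d a z - d a a'); first by lia.
  have ax : d a x = d a z.
    have := dT a a' x; have := dT a x b; have := dT x b' b; dlia.
  move=> y yw ay; have zx : d z x <= N.
    apply: (@slice_diam a b) => //.
    by have := dT a x b; have := dT x b' b; dlia.
  have a'y : d a' y <= N by apply: (@slice_diam a w).
  by have := dT z x y; have := dT x a' y; dlia.
have [le|ge] := leqP (2 * d u z) (2 * d u u' + d u' v').
  by left; apply: (half u v u' v' w'); dlia.
by right; apply: (half v u v' u' w'); dlia.
Qed.

Lemma four_point u v w x :
  d u v + d w x <= maxn (d u w + d v x) (d u x + d v w) + 3 * N.
Proof.
have [u1 [v1 [w1 [tri1 uv1 vw1 wu1]]]] := exists_quasi_median u v w.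
have [u2 [v2 [x2 [tri2 uv2 vx2 xu2]]]] := exists_quasi_median u v x.
have g1 := metric_triangle_le tri1; have g2 := metric_triangle_le tri2.
have thin y z : d u y + d y v = d u v -> d u z + d z v = d u v ->
    d y z <= N + (d u y - d u z) + (d u z - d u y) by exact: interval_thin.
have u1E : d u u1 + d u1 v = d u v by have := dT u u1 v; have := dT u1 v1 v; dlia.
have v1E : d u v1 + d v1 v = d u v by have := dT u v1 v; have := dT u u1 v1; dlia.
have u2E : d u u2 + d u2 v = d u v by have := dT u u2 v; have := dT u2 v2 v; dlia.
have v2E : d u v2 + d v2 v = d u v by have := dT u v2 v; have := dT u u2 v2; dlia.
(* Going from [w] to [x] through [v1] and [u2] exceeds the bound [d u x + d v w] by at most
   [N + 2 * max(0, a)], where [a = d u v1 - d u u2 <= N]. The other case goes through [u1] and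
   [v2]. *)
have [le|lt] := leqP (d u u1) (d u u2).
  have := thin v1 u2 v1E u2E; have := dT u1 v1 v; have := dT u2 v2 v.
  have := dT w v1 x; have := dT v1 u2 x; have := dT w w1 v1.
  by have := dT u2 x2 x; dlia.
have := thin u1 v2 u1E v2E; have := dT u1 v1 v; have := dT u2 v2 v.
have := dT w u1 x; have := dT u1 v2 x; have := dT w w1 u1.
by have := dT v2 x2 x; dlia.
Qed.

End BoundedTriangles.

End ConvexBalls.

(** * Graph distance *)
Section GraphDistance.

Variables (V : finType) (e : rel V).
Hypothesis simple : simple_graph e.
Hypothesis connected : connected_graph e.
Implicit Types (u v w x y z : V) (p q r : seq V).

Lemma walkP u v n :
  reflect (exists p, [/\ path e u p, last u p = v & size p = n])
          (walk_of_length e u v n).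
Proof.
apply: (iffP existsP) => [[p /andP[up /eqP pv]]|[p [up pv pn]]].
  by exists p; split=> //; rewrite size_tuple.
by exists (Tuple (introT eqP pn)); rewrite up /= pv eqxx.
Qed.

Lemma dist_le_card u v : dist e u v <= #|V|.
Proof. by rewrite /dist -{2}(size_iota 0 #|V|) find_size. Qed.

Lemma dist_le_walk u p : path e u p -> dist e u (last u p) <= size p.
Proof.
move=> up; have [le|lt] := leqP #|V| (size p).
  exact: leq_trans (dist_le_card _ _) le.
rewrite leqNgt; apply/negP => /(before_find 0); rewrite nth_iota // add0n.
by move/walkP; apply; exists p.
Qed.

Lemma exists_shortest_path u v : exists p, shortest_path e u v p.
Proof.
have /connectP[p /shortenP[q uq uniq_q _] ->] := connected u v.
apply/walkP; rewrite /dist; set s := iota _ _.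
(* A duplicate-free walk is shorter than [#|V|], so [find] succeeds and [dist] is not the junk
   value. *)
have lt : size q < #|V|.
  by have := max_card [in u :: q]; rewrite (card_uniqP uniq_q).
have hs : has (walk_of_length e u (last u q)) s.
  by apply/hasP; exists (size q); [rewrite mem_iota | apply/walkP; exists q].
have := nth_find 0 hs; rewrite nth_iota //.
by move: hs; rewrite has_find size_iota.
Qed.

Lemma distxx u : dist e u u = 0.
Proof. by apply/eqP; rewrite -leqn0; apply: (@dist_le_walk u [::]). Qed.

Lemma dist_eq0 u v : dist e u v = 0 -> u = v.
Proof.
by have [p [_ <- <-]] := exists_shortest_path u v; case: p.
Qed.

Lemma distC u v : dist e u v = dist e v u.
Proof.
have le x y : dist e x y <= dist e y x.
  have [p [yp <- <-]] := exists_shortest_path y x.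
  have := @dist_le_walk (last y p) (rev (belast y p)).
  rewrite size_rev size_belast.
  have -> : last (last y p) (rev (belast y p)) = y.
    by case: p {yp} => //= z p; rewrite rev_cons last_rcons.
  apply; rewrite rev_path; apply: sub_path yp => a b /=.
  by rewrite (proj1 simple).
by apply/eqP; rewrite eqn_leq !le.
Qed.

Lemma distT u v w : dist e u w <= dist e u v + dist e v w.
Proof.
have [p [up pv <-]] := exists_shortest_path u v.
have [q [vq qw <-]] := exists_shortest_path v w.
rewrite -size_cat -qw -pv -last_cat; apply: dist_le_walk.
by rewrite cat_path up pv.
Qed.

Lemma shortest_path_take u v p n : shortest_path e u v p -> n <= size p ->
  dist e u (last u (take n p)) = n /\
  dist e u (last u (take n p)) + dist e (last u (take n p)) v = dist e u v.
Proof.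
move=> [up pv pE] np; set x := last _ _.
move: up pv; rewrite -{1 2}(cat_take_drop n p) cat_path last_cat.
move=> /andP[/dist_le_walk ux /dist_le_walk xv] pv.
move: ux xv; rewrite pv -/x size_takel // size_drop pE => ux xv.
by have := distT u x v; lia.
Qed.

Lemma dist_geodesic u v n : n <= dist e u v ->
  exists2 x, dist e u x = n & dist e u x + dist e x v = dist e u v.
Proof.
have [p sp] := exists_shortest_path u v; have [_ _ pE] := (sp).
rewrite -{1}pE => np.
by have [ux xv] := shortest_path_take sp np; exists (last u (take n p)).
Qed.

Lemma shortest_path_interval u v p x : shortest_path e u v p -> x \in u :: p ->
  dist e u x + dist e x v = dist e u v.
Proof.
move=> sp; have [_ _ pE] := (sp).
case/splitPl def_p: {1}p / => [p1 p2 <-].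
have [|_] := shortest_path_take sp (n := size p1).
  by rewrite def_p size_cat leq_addr.
by rewrite def_p take_size_cat.
Qed.

Lemma shortest_path_level u v p n : shortest_path e u v p -> n <= dist e u v ->
  exists2 x, x \in u :: p & dist e u x = n.
Proof.
move=> sp; have [_ _ <-] := (sp) => np.
exists (last u (take n p)); last by case: (shortest_path_take sp np).
have := mem_last u (take n p).
by rewrite !inE => /predU1P[->|/mem_take ->]; rewrite ?eqxx ?orbT.
Qed.

Lemma dist_ball_convex : convex_balls e -> forall v (n : nat) x y z,
  dist e v x <= n -> dist e v y <= n ->
  dist e x z + dist e z y = dist e x y -> dist e v z <= n.
Proof.
move=> cvx v n x y z vx vy xzy.
have /subsetP/(_ z) : Defs.interval e x y \subset ball e v n.
  by apply: cvx; rewrite inE distC.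
by rewrite !inE xzy eqxx distC; apply.
Qed.

End GraphDistance.

Lemma sort3_gap (a b c N : nat) : a <= maxn b c + N -> b <= maxn a c + N ->
  c <= maxn a b + N ->
  nth 0 (sort geq [:: a; b; c]) 0 <= nth 0 (sort geq [:: a; b; c]) 1 + N.
Proof.
move=> ab bc ca; rewrite /sort /=.
repeat (case: ifP => ? /=); lia.
Qed.

(** * Bow metric, slimness and hyperbolicity *)

Section BowMetric.

Variables (R : realFieldType) (lambda mu : R) (V : finType) (e : rel V).
Hypothesis lambda_ge0 : (0 <= lambda)%R.
Hypothesis mu_ge0 : (0 <= mu)%R.
Hypothesis simple : simple_graph e.
Hypothesis connected : connected_graph e.
Hypothesis cvx : convex_balls e.
Hypothesis bow : bow_metric e lambda mu.

Local Notation d := (dist e).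
Local Notation K := (Num.max 2 (lambda + 2 * mu + 1))%R.

Let dxx := distxx e.
Let d_eq0 := dist_eq0 connected.
Let dC := distC simple connected.
Let dT := distT connected.
Let geodesic := dist_geodesic connected.
Let ball_convex := dist_ball_convex simple connected cvx.

Lemma bow_metric_triangle_le u v w : metric_triangle d u v w ->
  ((d u v)%:R <= K)%R.
Proof.
move=> tri; have typ := metric_triangle_type dxx d_eq0 dC dT geodesic ball_convex tri.
rewrite le_max; apply/orP; have [uv2|uv3] := leqP (d u v) 2.
  by left; rewrite (ler_nat R _ 2).
have [vw wu] : d v w = d u v /\ d w u = d u v by case: typ => [|[[]|[]|[]]]; lia.
right; rewrite leNgt; apply/negP => big.
(* [equilateral_bow] needs [m] above 1 and the bow inequality needs it above [lambda]; the least
   such [m] has [m - 1 <= lambda] unless [m = 2]. *)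
pose P m := (1 < m)%N && (lambda < m%:R)%R.
have Puv : P (d u v).
  apply/andP; split; first by lia.
  by apply: lt_trans big; move: mu_ge0; lra.
case: (@ex_minnP P) => [|m /andP[m2 lm] mmin]; first by exists (d u v).
have muv : m <= d u v by exact: mmin.
have [|p [q [vp pq qu vq pu]]] := @equilateral_bow _ _ dxx d_eq0 dC dT geodesic ball_convex
  u v w (d u v) m tri erefl vw wu.
  by rewrite m2.
have := @bow v p q u; rewrite !inE vq pu pq => /(_ _ _ lm).
rewrite (dC v u) => H.
have {H} : ((d v p)%:R + m%:R + (d q u)%:R - mu <= (d u v)%:R)%R.
  by apply: H; lia.
have -> : d q u = d v p by lia.
move: big; have -> : d u v = (d v p + m)%N by lia.
rewrite natrD => big vp_mu; have [m_le2|m_gt2] := leqP m 2.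
  (* Here [1 <= d v p <= mu], so [d u v <= mu + 2 <= 2 * mu + 1]: this uses the coefficient 2 of
     [mu]. *)
  have : (1 <= (d v p)%:R :> R)%R by rewrite (ler_nat R 1); lia.
  have : (m%:R <= 2 :> R)%R by rewrite (ler_nat R _ 2).
  by move: lambda_ge0 mu_ge0; lra.
have : ~~ P m.-1 by apply/negP => /mmin; lia.
rewrite negb_and -leqNgt -leNgt => /orP[|lm']; first by lia.
have : (m%:R = m.-1%:R + 1 :> R)%R by rewrite natr1 (ltn_predK m_gt2).
by move: mu_ge0; lra.
Qed.

Lemma exists_metric_triangle_bound : exists N,
  (N%:R <= K)%R /\ forall u v w, metric_triangle d u v w -> d u v <= N.
Proof.
(* Capping by [#|V|], which bounds all distances, provides a largest such [n] even if [R] is not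
   archimedean. *)
pose P n := (n <= #|V|) && (n%:R <= K)%R.
have exP : exists n, P n by exists 0; rewrite /P le_max ler0n.
case: (@ex_maxnP P #|V| exP) => [n /andP[]//|N /andP[_ NK] Nmax].
exists N; split=> // u v w tri; apply: Nmax.
by rewrite /P dist_le_card (bow_metric_triangle_le tri).
Qed.

Lemma convex_bow_slim : slim e (5 / 2 * K)%R.
Proof.
have [N [NK triN]] := exists_metric_triangle_bound.
have side u v w p q r : shortest_path e u v p -> shortest_path e v w q ->
    shortest_path e w u r ->
    side_within e (5 / 2 * K)%R (u :: p) ((v :: q) ++ (w :: r)).
  move=> sp sq sr z zp.
  suff [y yqr zy] : exists2 y, y \in (v :: q) ++ (w :: r) & 2 * d z y <= 5 * N.
    exists y => //; move: zy; rewrite -(ler_nat R) !natrM; move: NK.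
    by set k := Num.max _ _; lra.
  have [] := near_side dxx d_eq0 dC dT geodesic ball_convex triN w
    (shortest_path_interval connected sp zp).
  - case=> t tle near.
    (* The side [r] starts at [w], so level [t] from [u] is level [d w u - t] on it. *)
    have [|y yr wy] := shortest_path_level connected sr (n := d w u - t).
      exact: leq_subr.
    have wyu := shortest_path_interval connected sr yr.
    exists y; first by rewrite mem_cat yr orbT.
    by move: tle; rewrite (dC u w) => tle; apply: near;
      rewrite 1?(dC u y) 1?(dC y w) 1?(dC u w); lia.
  - case=> t tle near.
    have [y yq vy] := shortest_path_level connected sq tle.
    exists y; first by rewrite mem_cat yq.
    by apply: near; first exact: shortest_path_interval yq.
move=> u v w p q r sp sq sr; split; first exact: side.
  exact: side sq sr sp.
exact: side sr sp sq.
Qed.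

(** Distances are integers, so only the integer part of [t] matters. *)
Lemma slim_floor (t : R) n : (t < n.+1%:R)%R -> slim e t -> slim e (n%:R : R)%R.
Proof.
have within A B : (t < n.+1%:R)%R -> side_within e t A B ->
    side_within e (n%:R : R)%R A B.
  move=> tn AB z /AB[y yB zy]; exists y => //.
  by rewrite ler_nat -ltnS -(ltr_nat R) (le_lt_trans zy tn).
by move=> tn sl u v w p q r sp sq sr; have [] := sl u v w p q r sp sq sr;
  split; apply: within.
Qed.

(** [#|V|] is a slimness constant, so a least natural one exists classically; by [slim_floor] it is
    least in [R] too. *)
Lemma exists_slimness (s : R) : (0 <= s)%R -> slim e s ->
  exists2 t : R, is_slimness e t & (t <= s)%R.
Proof.
move=> s_ge0 sl.
have [n sln nmin] : exists2 n, slim e (n%:R : R)%R &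
    forall m, slim e (m%:R : R)%R -> n <= m.
  have : slim e (#|V|%:R : R)%R.
    have within A x B : side_within e (#|V|%:R : R)%R A (x :: B).
      by move=> z _; exists x; rewrite ?mem_head // ler_nat dist_le_card.
    by move=> u v w p q r _ _ _; split; apply: within.
  elim/ltn_ind: #|V| => n IH sln.
  have [[m mn slm]|none] := classic (exists2 m, m < n & slim e (m%:R : R)%R).
    exact: IH slm.
  exists n => // m slm; rewrite leqNgt; apply/negP => mn.
  by apply: none; exists m.
have least (t : R) : (0 <= t)%R -> slim e t -> (n%:R <= t)%R.
  move=> t_ge0 slt; case: n nmin {sln} => [//|n] nmin.
  rewrite leNgt; apply/negP => tn.
  by have := nmin n (slim_floor tn slt); rewrite ltnn.
by exists (n%:R)%R; [split; rewrite ?ler0n | apply: least].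
Qed.

Lemma convex_bow_hyperbolic : hyperbolic e (5 / 2 * K)%R.
Proof.
have [N [NK triN]] := exists_metric_triangle_bound.
have four u v w x := four_point dxx d_eq0 dC dT geodesic ball_convex triN u v w x.
move=> u v w x /=.
have := @sort3_gap (d u v + d w x) (d u w + d v x) (d u x + d v w) (3 * N).
set s := sort _ _ => gap.
have : nth 0 s 0 <= nth 0 s 1 + 3 * N.
  apply: gap.
  - exact: four.
  - by have := four u w v x; rewrite (dC w v).
  - by have := four u x w v; rewrite (dC x v) (dC x w) (dC w v) maxnC; lia.
rewrite -(ler_nat R) natrD natrM; move: NK (ler0n R N).
by set k := Num.max _ _; lra.
Qed.

End BowMetric.

Local Open Scope ring_scope.

Theorem theorem5 (R : realFieldType) (lambda mu : R) (V : finType) (e : rel V)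
  (hlambda : 0 <= lambda) (hmu : 0 <= mu)
  (hsimple : simple_graph e) (hconn : connected_graph e)
  (hballs : convex_balls e) (hbow : bow_metric e lambda mu) :
  (exists2 s : R, is_slimness e s
     & s <= 5 / 2 * Num.max 2 (lambda + 2 * mu + 1)) /\
  hyperbolic e (5 / 2 * Num.max 2 (lambda + 2 * mu + 1)).
Proof.
split; last exact: convex_bow_hyperbolic.
apply: exists_slimness; last exact: convex_bow_slim.
by apply: mulr_ge0; rewrite ?le_max ?ler0n // divr_ge0 ?ler0n.
Qed.
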